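(* Let $(X_3,\|\cdot\|_{X_3})\subset(X_2,\|\cdot\|_{X_2})\subset(X_1,\|\cdot\|_{X_1})$ be Banach spaces with continuous inclusions, let $I\subset\mathbb R$ be an open interval and let $u^{(\cdot)}:I\to X_3$, $t\mapsto u^t$, be such that (the same choice of the norm topology or of the weak topology of $X_1$ being made in (i) and (ii)): (i) $u^{(\cdot)}$ is differentiable with respect to the norm (or the weak) topology of $X_1$, with derivative $\dot u^t$ at $t\in I$; (ii) $\dot u^t\in X_3$ for all $t\in I$, and the map $\dot u^{(\cdot)}:I\to X_3$, $t\mapsto\dot u^t$, is continuous with respect to the norm (or the weak) topology of $X_1$; (iii) the closure of $\dot u^I:=\{\dot u^t: t\in I\}$ in $(X_3,\|\cdot\|_{X_3})$ is relatively compact in $(X_2,\|\cdot\|_{X_2})$. Then for every $t\in I$, $\dot u^t$ is the derivative of $u^{(\cdot)}$ at $t$ in $(X_2,\|\cdot\|_{X_2})$. Moreover $t\mapsto\dot u^t\in X_3$ is continuous with respect to the norm topology of $X_2$.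
   Context: The weak topology of $X_1$ is generated by the seminorms $|l(\cdot)|$, $l\in X_1'$. A map $t\mapsto x^t$ is differentiable at $t$ with derivative $\dot x^t$ with respect to a topology if $\frac1h(x^{t+h}-x^t)\to\dot x^t$ as $h\to0$ in that topology. *)

(* Defs.v *)
From HB Require Import structures.
From mathcomp Require Import finmap all_boot all_order all_algebra.
From mathcomp Require Import all_classical all_reals all_analysis.
Import Order.TTheory GRing.Theory Num.Theory.
Import numFieldNormedType.Exports.

Set Implicit Arguments.
Unset Strict Implicit.
Unset Printing Implicit Defensive.

Local Open Scope classical_set_scope.
Local Open Scope ring_scope.

Definition topological_dual (R : realType) (X : normedModType R) :
    set (X -> R) :=
  [set l : X -> R | scalar l /\ continuous (l : X -> R^o)].

(* A copy of the vector space X, equipped below with the weak topology of X in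
   place of the norm topology. *)
Definition weak (R : realType) (X : normedModType R) : Type := X.

Section weak_topology.
Context (R : realType) (X : normedModType R).

HB.instance Definition _ := GRing.Lmodule.on (weak X).

(* The topology generated by the seminorms |l|, l in the dual, has the open
   balls {y | |l (y - x)| < e} of these seminorms as a subbase; p = (l, x, e)
   is the index of such a ball. *)
Definition weak_index : set ((X -> R) * X * R) :=
  [set p | topological_dual p.1.1 /\ 0 < p.2].

Definition weak_ball (p : (X -> R) * X * R) : set (weak X) :=
  [set y : X | `|p.1.1 (y - p.1.2)| < p.2].

HB.instance Definition _ :=
  isSubBaseTopological.Build (weak X) weak_index weak_ball.

Lemma weak_cvgP (F : set_system X) (x : X) : Filter F ->
  F --> (x : weak X) <->
  forall l, topological_dual l ->
    (fun y => `|l (y - x)|) @ F --> (0 : R).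
Proof.
move=> FF; have dual0 (l : X -> R) : topological_dual l -> l 0 = 0.
  by move=> [ll _]; have := ll (- 1) 0 0; rewrite scaler0 addr0 mulN1r addNr.
have dualB (l : X -> R) y z : topological_dual l -> l (y - z) = l y - l z.
  move=> [ll _]; have := ll (- 1) z y.
  by rewrite scaleN1r mulN1r [- z + y]addrC [- l z + l y]addrC.
split=> [Fx l dl|Fx].
  apply/cvgrPdist_lt => e e0; rewrite near_map; apply: Fx; rewrite /= nbhsE.
  exists (weak_ball (l, x, e)); last first.
    by move=> y /=; rewrite /weak_ball /= sub0r normrN normr_id.
  split; last by rewrite /weak_ball /= subrr dual0// normr0.
  exists [set (weak_ball (l, x, e))]; last by rewrite bigcup_set1 //.
  move=> _ ->; exists [fset (l, x, e)]%fset.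
    by move=> p; rewrite !inE => /eqP ->.
  rewrite predeqE => y; split=> [|yB p /=]; last by rewrite inE => /eqP ->.
  by apply; rewrite /= inE.
move=> A /=; rewrite (@nbhsE (weak X)) => -[_ [[B sB <-] [C BC Cx] sBA]].
apply: filterS sBA _; apply: (@filterS _ _ _ C) => [y Cy|]; first by exists C.
have /sB [D sD IDC] := BC; rewrite -IDC; apply: filter_bigI => -[[l z] e] De.
have /set_mem/= [/= dl e0] := sD _ De.
have : weak_ball (l, z, e) x by move: Cx; rewrite -IDC; apply.
rewrite /weak_ball/= => xze.
have /cvgrPdist_lt/(_ (e - `|l (x - z)|)) := Fx l dl.
rewrite subr_gt0 => /(_ xze); rewrite near_map; apply: filterS => y.
rewrite sub0r normrN normr_id ltrBrDr; apply: le_lt_trans.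
by rewrite !dualB// ler_distD.
Qed.

End weak_topology.

(* The derivative at t, for the topology carried by E, of a map x defined near
   t; see has_derivative_normE for normed spaces. *)
Definition has_derivative (R : realType) (E : preTopologicalLmodType R)
    (x : R -> E) (t : R) (dx : E) : Prop :=
  (fun h => h^-1 *: (x (t + h) - x t)) @ 0^' --> dx.

Lemma has_derivative_normE (R : realType) (E : normedModType R)
    (x : R -> E) (t : R) (dx : E) :
  has_derivative x t dx <-> is_derive t 1 x dx.
Proof.
have qE : (fun h : R => h^-1 *: (x (t + h) - x t)) =
    (fun h : R => h^-1 *: ((x \o shift t) (h *: 1) - x t)).
  by apply/funext => h /=; rewrite -[h%:A]/(h * 1) mulr1 (addrC t).
rewrite /has_derivative qE; split=> [dxE|[xt <-]]; last exact: xt.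
by split; [apply/cvg_ex; exists dx|apply: cvg_lim].
Qed.

(* Main.v *)
(* The topological dual of X1 separates points by Hahn-Banach, so its
   restrictions to X2 form a family L of continuous functionals on X2 which
   separates points, and both versions of (i) and (ii) hold after applying each
   l in L. As du takes its values in a compact set of X2, its only cluster point
   at t in X2 is du t: this is the continuity of du in X2. Then du has Riemann
   integrals in the Banach space X2, and the functionals in L identify the
   difference quotients of u with the means of du, which tend to du t. *)
Require Import Defs.
From HB Require Import structures.
From mathcomp Require Import all_boot all_order all_algebra.
From mathcomp Require Import all_classical all_reals all_analysis.
From mathcomp Require Import ring lra.
Import Order.TTheory GRing.Theory Num.Theory.
Import numFieldNormedType.Exports.

Set Implicit Arguments.
Unset Strict Implicit.
Unset Printing Implicit Defensive.

Local Open Scope classical_set_scope.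
Local Open Scope ring_scope.

(** * Algebra of linear forms *)

Section scalar_form.
Context (R : pzRingType) (V : lmodType R) (l : V -> R).
Hypothesis l_scalar : scalar l.

Lemma scalar_formB x y : l (x - y) = l x - l y.
Proof. by rewrite addrC -scaleN1r l_scalar mulN1r addrC. Qed.

Lemma scalar_form0 : l 0 = 0.
Proof. by rewrite -(subrr 0) scalar_formB subrr. Qed.

Lemma scalar_formZ a x : l (a *: x) = a * l x.
Proof. by rewrite -[a *: x]addr0 l_scalar scalar_form0 addr0. Qed.

End scalar_form.

(** * The Hahn-Banach theorem for the norm *)

Section hahn_banach.
Context (R : realType) (X : normedModType R).

(** Encoding partial functionals by their graphs makes unions of chains immediate. Single-valuedness
    comes for free: two values [c] and [d] at one point put [(0, c - d)] and [(0, d - c)] in the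
    graph, and domination bounds both differences by 0. *)
Definition dominated_graph (A : set (X * R)) :=
  (forall a p q, A p -> A q -> A (a *: p.1 + q.1, a * p.2 + q.2)) /\
  (forall p, A p -> p.2 <= `|p.1|).

Lemma dominated_graph_line (x0 : X) :
  dominated_graph [set (a *: x0, a * `|x0|) | a in setT].
Proof.
split=> [a _ _ [b _ <-] [c _ <-]|_ [a _ <-]] /=.
  by exists (a * b + c) => //; rewrite scalerDl scalerA mulrDl mulrA.
by rewrite normrZ ler_wpM2r// ler_norm.
Qed.

Lemma dominated_graph_extend (A : set (X * R)) (y : X) :
  dominated_graph A -> A !=set0 ->
  exists2 B, dominated_graph B & A `<=` B /\ exists c, B (y, c).
Proof.
move=> [Alin Adom] [p0 Ap0].
have A00 : A (0, 0).
  have := Alin (- 1) p0 p0 Ap0 Ap0.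
  by rewrite scaleN1r mulN1r !addNr.
have Ascale a p : A p -> A (a *: p.1, a * p.2).
  by move=> Ap; have := Alin a p _ Ap A00; rewrite !addr0.
(* The value c at y must satisfy s - |z - y| <= c <= |x + y| - r for all
   (z, s) and (x, r) in A. *)
pose S := [set p.2 - `|p.1 - y| | p in A].
have Sub p : A p -> ubound S (`|p.1 + y| - p.2).
  move=> Ap _ [q Aq <-]; rewrite lerBrDr addrAC lerBlDr.
  have /Adom/= := Alin 1 _ _ Ap Aq; rewrite scale1r mul1r addrC => /le_trans.
  apply; rewrite (_ : p.1 + q.1 = (p.1 + y) + (q.1 - y)); last first.
    by rewrite addrACA subrr addr0.
  exact: ler_normD.
have cge p : A p -> p.2 - `|p.1 - y| <= sup S.
  move=> Ap; apply: ub_le_sup; last by exists p.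
  by eexists; exact: Sub A00.
have cle p : A p -> sup S <= `|p.1 + y| - p.2.
  move=> Ap; apply: ge_sup; last exact: Sub.
  by eexists; exists p.
exists [set (q.1.1 + q.2 *: y, q.1.2 + q.2 * sup S) | q in [set q | A q.1]].
  split=> [a _ _ [[p b] /= Ap <-] [[q c] /= Aq <-]|_ [[p a] /= Ap <-]] /=.
    exists ((a *: p.1 + q.1, a * p.2 + q.2), a * b + c) => /=.
      exact: Alin.
    congr pair; last by ring.
    by rewrite scalerDr scalerA scalerDl addrACA.
  (* Dividing by [|a|] reduces the bound to [cle] if [a > 0] and to [cge] if [a < 0]. *)
  case: (ltgtP a 0) => [a0|a0|->]; last first.
  - by rewrite scale0r mul0r !addr0; exact: Adom.
  - have := cle _ (Ascale a^-1 _ Ap); rewrite /= -(ler_pM2l a0) mulrBr.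
    rewrite -{2}(gtr0_norm a0) -normrZ scalerDr !scalerA mulrA divff ?gt_eqF//.
    by rewrite scale1r mul1r; lra.
  - have Na0 : 0 < - a by rewrite oppr_gt0.
    have := cge _ (Ascale (- a)^-1 _ Ap); rewrite /= -(ler_pM2l Na0) mulrBr.
    rewrite -{3}(gtr0_norm Na0) -normrZ scalerBr !scalerA mulrA divff ?gt_eqF//.
    by rewrite scale1r mul1r scaleNr opprK; lra.
split=> [p Ap|].
  by exists (p, 0); rewrite //= scale0r mul0r !addr0; case: p Ap.
by exists (sup S); exists ((0, 0), 1); rewrite //= !add0r scale1r mul1r.
Qed.

Lemma hahn_banach_norm (x0 : X) :
  exists2 l : X -> R, topological_dual l & l x0 = `|x0|.
Proof.
pose L := [set (a *: x0, a * `|x0|) | a in [set: R]].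
(* Zorn's lemma also asks for the union of the empty chain, so [P] admits the empty set; maximality
   excludes it afterwards, since [L] lies strictly above it. *)
pose P A := dominated_graph A /\ (A !=set0 -> L `<=` A).
have [A [[Agraph LA] Amax]] : exists A, P A /\ forall B, A `<` B -> ~ P B.
  apply: Zorn_bigcup => F FP Ftot; split; last first.
    move=> [p [A FA Ap]] q Lq; exists A => //.
    by apply: (FP _ FA).2 Lq; exists p.
  split=> [a p q [A FA Ap] [B FB Bq]|p [A FA Ap]]; last exact: (FP _ FA).1.2.
  have [AB|BA] := Ftot _ _ FA FB.
    by exists B => //; apply: (FP _ FB).1.1 => //; exact: AB.
  by exists A => //; apply: (FP _ FA).1.1 => //; exact: BA.
have L0 : L !=set0 by exists (1 *: x0, 1 * `|x0|); exists 1.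
have A0 : A !=set0.
  apply/set0P/eqP => A0; apply: (Amax L); last first.
    by split=> [|_]; [exact: dominated_graph_line|].
  by rewrite A0; split=> //; case: L0 => p Lp /(_ _ Lp).
have Adom y : exists c, A (y, c).
  have [B Bgraph [AB [c Byc]]] := dominated_graph_extend y Agraph A0.
  exists c; apply: contrapT => Ayc; apply: (Amax B).
    by split=> // /(_ _ Byc).
  by split=> // _; exact: subset_trans (LA A0) AB.
have [Alin Ale] := Agraph.
have Afun y c d : A (y, c) -> A (y, d) -> c <= d.
  move=> Ac Ad; have /Ale := Alin (- 1) _ _ Ad Ac.
  by rewrite /= scaleN1r addNr normr0 mulN1r addrC subr_le0.
have [l Al] := choice Adom.
have lE y c : A (y, c) -> l y = c.
  by move=> Ac; apply/le_anti; rewrite !(Afun y).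
have l_lin : scalar l by move=> a y z; apply/lE/(Alin a _ _ (Al y) (Al z)).
exists l; last by apply/lE/(LA A0); exists 1; rewrite // scale1r mul1r.
(* Domination at [y - z] and at its opposite makes [l] 1-Lipschitz. *)
split=> // y; apply/cvgrPdist_lt => e e0.
near=> z; apply: (@le_lt_trans _ _ `|y - z|).
  rewrite -(scalar_formB l_lin) ler_norml (Ale _ (Al _)) andbT.
  rewrite lerNl -normrN; apply: (Ale (- (y - z), - l (y - z))).
  have := Alin (- 1) _ _ (Al (y - z)) (Al 0).
  by rewrite /= (scalar_form0 l_lin) !addr0 scaleN1r mulN1r.
near: z; exact: cvgr_dist_lt.
Unshelve. all: by end_near. Qed.

End hahn_banach.

Lemma topological_dual_separates (R : realType) (X : normedModType R)
    (x y : X) :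
  (forall l : X -> R, topological_dual l -> l x = l y) -> x = y.
Proof.
move=> lxy; apply/eqP; rewrite -subr_eq0 -normr_eq0.
have [l dl <-] := hahn_banach_norm (x - y).
by have [l_lin _] := dl; rewrite (scalar_formB l_lin) lxy// subrr.
Qed.

(** * Dyadic Riemann sums *)

Section dyadic_mean.
Context (R : realType).

(* The left Riemann sum of w on [a, b] for the subdivision into 2 ^ n equal
   pieces, divided by b - a. *)
Fixpoint dyadic_mean (V : lmodType R) (w : R -> V) (n : nat) (a b : R) : V :=
  if n is m.+1 then
    2^-1 *: (dyadic_mean w m a ((a + b) / 2) + dyadic_mean w m ((a + b) / 2) b)
  else w a.

Lemma linear_dyadic_mean (V : lmodType R) (l : V -> R) (w : R -> V) n a b :
  scalar l ->
  l (dyadic_mean w n a b) = dyadic_mean (l \o w : R -> R^o) n a b.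
Proof.
move=> l_lin; elim: n a b => //= n IH a b.
by rewrite (scalar_formZ l_lin) -[dyadic_mean w n a _]scale1r l_lin mul1r !IH.
Qed.

(** The distance allowed is the mesh of the [n]-th subdivision. It is unchanged when the interval is
    halved and [n] lowered by one, which drives the inductions below. *)
Definition small_oscillation (V : normedModType R) (w : R -> V) (n : nat)
    (e a b : R) :=
  forall x y, a <= x <= b -> a <= y <= b -> `|x - y| <= (b - a) / 2 ^+ n ->
    `|w x - w y| <= e.

Lemma small_oscillation_halves (V : normedModType R) (w : R -> V) n e a b :
  a <= b -> small_oscillation w n.+1 e a b ->
  small_oscillation w n e a ((a + b) / 2) /\
  small_oscillation w n e ((a + b) / 2) b.
Proof.
move=> ab osc.
have le2 : (b - a) / 2 ^+ n.+1 = (b - a) / 2 / 2 ^+ n.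
  by rewrite exprS invfM mulrA.
split=> x y xab yab xy; apply: osc; rewrite ?le2.
- by lra.
- by lra.
- by rewrite (_ : (b - a) / 2 = (a + b) / 2 - a)//; lra.
- by lra.
- by lra.
- by rewrite (_ : (b - a) / 2 = b - (a + b) / 2)//; lra.
Qed.

Lemma half_norm_le (V : normedModType R) (x y : V) (e : R) :
  `|x| <= e -> `|y| <= e -> `|2^-1 *: (x + y)| <= e.
Proof.
move=> xe ye; rewrite normrZ ger0_norm ?invr_ge0//.
have := ler_normD x y; lra.
Qed.

(** The mean is a convex combination of values of [w], and closed balls are convex. *)
Lemma dyadic_mean_dist_le (V : normedModType R) (w : R -> V) n a b z e :
  a <= b -> (forall s, a <= s <= b -> `|w s - z| <= e) ->
  `|dyadic_mean w n a b - z| <= e.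
Proof.
elim: n a b => /= [|n IH] a b ab wz; first by apply: wz; rewrite lexx.
have -> (x y : V) : 2^-1 *: (x + y) - z = 2^-1 *: ((x - z) + (y - z)).
  rewrite addrACA -opprD scalerBr; congr (_ - _).
  by rewrite -[z + z]mulr2n -[z *+ 2]scaler_nat scalerA mulVf ?scale1r.
by apply: half_norm_le; apply: IH => [|s sab]; [lra|apply: wz; lra|lra|
  apply: wz; lra].
Qed.

(** On each piece of the coarse subdivision, the finer mean averages values within [e] of the value
    at the left end. *)
Lemma dyadic_mean_refine (V : normedModType R) (w : R -> V) n m a b e :
  a <= b -> small_oscillation w n e a b ->
  `|dyadic_mean w (n + m) a b - dyadic_mean w n a b| <= e.
Proof.
elim: n a b => [|n IH] a b ab osc.
  apply: dyadic_mean_dist_le => // s sab; apply: osc => //.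
    by rewrite lexx.
  by rewrite expr0 divr1 ger0_norm; lra.
rewrite addSn /= -scalerBr opprD addrACA.
have [osc1 osc2] := small_oscillation_halves ab osc.
by apply: half_norm_le; apply: IH => //; lra.
Qed.

(** On each piece the mean value theorem writes the increment of [f] as the length times a value of
    [g], which is within [e] of the value at the left end. *)
Lemma dyadic_mean_derive (f g : R -> R) n (a b e : R) : a <= b ->
  (forall x : R, a <= x <= b -> is_derive x 1 f (g x)) ->
  small_oscillation (g : R -> R^o) n e a b ->
  `|(f b - f a) - (b - a) * dyadic_mean (g : R -> R^o) n a b| <= (b - a) * e.
Proof.
elim: n a b => [|n IH] a b ab fg osc /=.
  have [||c cab ->] := @MVT_segment R f g a b ab.
  - by move=> x; rewrite in_itv /= => /andP[ax xb]; apply: fg; rewrite !ltW.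
  - apply: derivable_within_continuous => x; rewrite in_itv /= => xab.
    by have [] := fg _ xab.
  have ba : 0 <= b - a by rewrite subr_ge0.
  rewrite mulrC -mulrBr normrM ger0_norm// ler_wpM2l//; apply: osc.
  - by move: cab; rewrite in_itv.
  - by rewrite lexx.
  - by move: cab; rewrite in_itv /= expr0 divr1 => cab; rewrite ger0_norm; lra.
have [osc1 osc2] := small_oscillation_halves ab osc.
have am : a <= (a + b) / 2 by lra.
have mb : (a + b) / 2 <= b by lra.
have H1 := IH _ _ am _ osc1; have H2 := IH _ _ mb _ osc2.
move: H1 H2; rewrite -[_ *: _]/(_ * _).
set D1 := dyadic_mean _ _ _ _; set D2 := dyadic_mean _ _ _ _ => H1 H2.
have {}H1 : `|f ((a + b) / 2) - f a - ((a + b) / 2 - a) * D1|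
    <= ((a + b) / 2 - a) * e by apply: H1 => x xab; apply: fg; lra.
have {}H2 : `|f b - f ((a + b) / 2) - (b - (a + b) / 2) * D2|
    <= (b - (a + b) / 2) * e by apply: H2 => x xab; apply: fg; lra.
have -> : f b - f a - (b - a) * (2^-1 * (D1 + D2)) =
    (f ((a + b) / 2) - f a - ((a + b) / 2 - a) * D1) +
    (f b - f ((a + b) / 2) - (b - (a + b) / 2) * D2).
  by field.
by apply: le_trans (ler_normD _ _) _; lra.
Qed.

(** Heine-Cantor, by the near-covering form of compactness with the radius [d] tending to 0 from the
    right. *)
Lemma segment_unif_continuous (V : normedModType R) (w : R -> V) a b e :
  (forall x, a <= x <= b -> {for x, continuous w}) -> 0 < e ->
  exists2 d, 0 < d & forall x y, a <= x <= b -> a <= y <= b -> `|x - y| < d ->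
    `|w x - w y| <= e.
Proof.
move=> wc e0.
have /compact_near_coveringP := @segment_compact R a b.
move=> /(_ R 0^'+ (fun d x => forall y, `|x - y| < d -> `|w x - w y| <= e) _).
case.
  move=> x /=; rewrite in_itv /= => xab.
  have e20 : 0 < e / 2 by exact: divr_gt0.
  have /cvgrPdist_le/(_ _ e20) := wc _ xab; move=> /nbhs_ballP[r /= r0 xr].
  (* With half the radius, both [x'] and any [y] within [d] of [x'] stay within [r] of [x]. *)
  exists (ball x (r / 2), [set d | d < r / 2]) => /=.
    by split; [apply: nbhsx_ballx; exact: divr_gt0|
      apply: nbhs_right_lt; exact: divr_gt0].
  move=> [x' d] [/= xx' dr] y x'y.
  rewrite (_ : w x' - w y = (w x' - w x) + (w x - w y)); last first.
    by rewrite addrA subrK.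
  rewrite (le_trans (ler_normD _ _))// [e]splitr lerD//.
    rewrite distrC; apply: xr; apply: le_ball xx'.
    by rewrite ler_pdivrMr// ler_peMr ?ler1n// ltW.
  apply: xr; rewrite /ball /=; rewrite /ball /= in xx'.
  have := ler_distD x' x y; lra.
move=> d /= d0 dP; exists (d / 2); first exact: divr_gt0.
move=> x y xab yab xy; apply: (dP (d / 2)) => //=.
- by rewrite sub0r normrN gtr0_norm ?divr_gt0//; lra.
- exact: divr_gt0.
Qed.

End dyadic_mean.

Lemma near_small_oscillation (R : realType) (V : normedModType R) (w : R -> V)
    (a b e : R) :
  (forall x, a <= x <= b -> {for x, continuous w}) -> 0 < e ->
  \forall n \near \oo, small_oscillation w n e a b.
Proof.
move=> wc e0; have [d d0 wd] := segment_unif_continuous wc e0.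
have : geometric (b - a) 2^-1 @ \oo --> (0 : R).
  by apply: cvg_geometric; rewrite ger0_norm ?invr_ge0// invf_lt1// ltr1n.
move=> /cvgr_lt/(_ _ d0); apply: filterS => n /= nd x y xab yab xy.
by apply: wd => //; apply: le_lt_trans nd; rewrite exprVn.
Qed.

(** * Mean value inequality and derivatives tested on a separating family *)

Section weak_mean_value.
Context (R : realType) (Y : completeNormedModType R).

(** Refinement makes the means a Cauchy sequence; for [a < b] the limit is the integral of [w]
    divided by [b - a]. *)
Lemma cvg_dyadic_mean (w : R -> Y) (a b : R) : a <= b ->
  (forall x, a <= x <= b -> {for x, continuous w}) ->
  cvg (dyadic_mean w n a b @[n --> \oo]).
Proof.
move=> ab wc; apply/cauchy_cvgP/cauchy_exP => e e0 /=.
have [N _ wN] := near_small_oscillation wc (divr_gt0 e0 (ltr0n R 2)).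
exists (dyadic_mean w N a b); exists N => // n /= Nn.
rewrite -ball_normE /= distrC -(subnKC Nn).
apply: le_lt_trans (dyadic_mean_refine _ ab (wN _ (leqnn _))) _.
by lra.
Qed.

Variable L : set (Y -> R).
Hypothesis L_dual : L `<=` topological_dual (X := Y).
Hypothesis L_sep : forall x y, (forall l, L l -> l x = l y) -> x = y.

(* L need not be norming, so the norm bound is not available functional by
   functional; the difference quotient is the mean of w over [a, b], which is a
   norm limit in Y of convex combinations of values of w. *)
Lemma weak_mean_value_inequality (v w : R -> Y) (a b e : R) (z : Y) : a < b ->
  (forall x, a <= x <= b -> {for x, continuous w}) ->
  (forall l, L l -> forall x : R, a <= x <= b ->
     is_derive x 1 (l \o v : R -> R) (l (w x))) ->
  (forall s, a <= s <= b -> `|w s - z| <= e) ->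
  `|(b - a)^-1 *: (v b - v a) - z| <= e.
Proof.
move=> ab wc vw wz; have ba : 0 < b - a by rewrite subr_gt0.
have /cvg_ex[S DS] := cvg_dyadic_mean (ltW ab) wc.
(* Once the quotient is identified with [S], the bound follows because every mean lies in the closed
   ball around [z]. *)
suff -> : (b - a)^-1 *: (v b - v a) = S.
  have Sz : `|dyadic_mean w n a b - z| @[n --> \oo] --> `|S - z|.
    by apply: cvg_norm; apply: cvgB => //; exact: cvg_cst.
  apply: (closed_cvg (fun x : R => x <= e) (@closed_le R e) _ _ Sz).
  by apply: nearW => n; exact: dyadic_mean_dist_le (ltW ab) wz.
apply: L_sep => l Ll; have [l_lin lc] := L_dual Ll.
rewrite (scalar_formZ l_lin) (scalar_formB l_lin).
have lDS : dyadic_mean (l \o w : R -> R^o) n a b @[n --> \oo] --> l S.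
  under eq_fun do rewrite -linear_dyadic_mean//.
  exact: (cvg_comp _ _ DS (lc S)).
(* The real means of [l \o w] tend to [l S]; by the scalar estimate [dyadic_mean_derive] they also
   tend to the quotient of [l \o v]. *)
suff lD : dyadic_mean (l \o w : R -> R^o) n a b @[n --> \oo] -->
    ((b - a)^-1 * (l (v b) - l (v a)) : R^o) by exact: cvg_unique lD lDS.
apply/cvgrPdist_le => d d0.
have lwc x : a <= x <= b -> {for x, continuous (l \o w : R -> R^o)}.
  by move=> xab; apply: continuous_comp; [exact: wc|exact: lc].
have := near_small_oscillation lwc d0; apply: filterS => n osc.
rewrite -(ler_pM2l ba).
apply: le_trans (dyadic_mean_derive (ltW ab) (vw l Ll) osc).
rewrite -[X in X * _ <= _](gtr0_norm ba) -normrM mulrBr mulrA.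
by rewrite divff ?gt_eqF// mul1r.
Qed.

Lemma weak_derivative_strong (v w : R -> Y) (I : set R) (t : R) :
  open I -> I t ->
  (forall x, I x -> {for x, continuous w}) ->
  (forall l, L l -> forall x, I x ->
     has_derivative (l \o v : R -> R^o) x (l (w x))) ->
  has_derivative v t (w t).
Proof.
move=> I_open It wc vw; apply/cvgrPdist_le => e e0.
have : \forall s \near t, I s /\ `|w s - w t| <= e.
  near=> s; split; first by near: s; exact: open_nbhs_nbhs.
  rewrite distrC; near: s; move: (wc _ It) => /cvgrPdist_le; exact.
move=> /nbhs_ballP[r /= r0 tr].
(* Ordered endpoints serve both signs of [h]: for [h < 0] the segment is [[t + h, t]], and the two
   sign changes in the quotient cancel. *)
have quotient_le a b : a < b -> ball t r a -> ball t r b ->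
    `|(b - a)^-1 *: (v b - v a) - w t| <= e.
  move=> ab ta tb.
  have tab s : a <= s <= b -> I s /\ `|w s - w t| <= e.
    move=> sab; apply: tr; move: ta tb; rewrite /ball /= !ltr_norml; lra.
  apply: weak_mean_value_inequality =>
    // [x /tab[Ix _]|l Ll x /tab[Ix _]|s sab].
  - exact: wc.
  - exact/has_derivative_normE/vw.
  - by have [] := tab s sab.
near=> h.
have h0 : h != 0 by near: h; exact: nbhs_dnbhs_neq.
have hr : `|h| < r by near: h; exact: dnbhs0_lt.
have tt : ball t r t by exact: ballxx.
have tth : ball t r (t + h) by rewrite /ball /= opprD addNKr normrN.
rewrite distrC; case: (ltgtP h 0) h0 => // [hneg|hpos] _.
  have := quotient_le (t + h) t _ tth tt.
  rewrite opprD addNKr invrN scaleNr -scalerN opprB; apply; lra.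
have := quotient_le t (t + h) _ tt tth.
by rewrite addrAC subrr add0r; apply; lra.
Unshelve. all: by end_near. Qed.

End weak_mean_value.

(** * From weak to norm continuity by compactness *)

(** If [F] missed a neighbourhood [U] of [x], its trace on the complement of [U] would be proper and
    cluster in [K]. That point is a cluster point of [F], hence [x], which [U] separates from the
    trace. *)
Lemma compact_cluster_cvg (T : topologicalType) (K : set T) (F : set_system T)
    (x : T) : ProperFilter F -> compact K -> F K -> cluster F `<=` [set x] ->
  F --> x.
Proof.
move=> FF Kc FK Fx U xU; apply: contrapT => FU.
have GF : ProperFilter (within (~` U) F).
  apply: Build_ProperFilter_ex => P; rewrite /within /= => FP.
  apply: contrapT => P0; apply: FU; apply: filterS FP => y yP.
  by apply: contrapT => Uy; apply: P0; exists y; exact: yP.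
have GK : within (~` U) F K by apply: filterS FK => y Ky _.
have [y [_ Gy]] := Kc _ GF GK.
have yx : y = x by apply: Fx; exact: (cvg_cluster (@cvg_within _ _ _ _)) Gy.
have GU : within (~` U) F (~` U) by rewrite /within /=; exact: nearW.
by rewrite yx in Gy; have [z []] := Gy _ _ GU xU.
Qed.

(** A cluster point [y] of [w] at [t] satisfies [l y = l (w t)] for all [l] in [L], as [R] is
    Hausdorff; hence it is [w t]. *)
Lemma weak_continuous_compact (R : realType) (T : topologicalType)
    (Y : normedModType R) (L : set (Y -> R)) (K : set Y) (w : T -> Y) (t : T) :
  L `<=` topological_dual (X := Y) ->
  (forall x y, (forall l, L l -> l x = l y) -> x = y) ->
  compact K -> (\forall s \near t, K (w s)) ->
  (forall l, L l -> {for t, continuous (l \o w : T -> R)}) ->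
  {for t, continuous w}.
Proof.
move=> L_dual L_sep Kc wK lw; apply: (compact_cluster_cvg _ Kc wK) => y wy.
apply: L_sep => l Ll; have [_ lc] := L_dual _ Ll.
apply: (@Rhausdorff R) => A B /= lyA lwB.
have [z [wz Az]] := wy (l @^-1` B) (l @^-1` A) (lw l Ll B lwB) (lc y A lyA).
by exists (l z).
Qed.

(** * Convergence in the weak topology *)

Lemma weak_cvg_dual (R : realType) (X : normedModType R) (T : Type)
    (F : set_system T) {FF : Filter F} (f : T -> weak X) (x : X) (l : X -> R) :
  topological_dual l -> f @ F --> (x : weak X) -> l \o f @ F --> l x.
Proof.
move=> dl /weak_cvgP/(_ l dl) /cvgrPdist_lt lf; have [l_lin _] := dl.
apply/cvgrPdist_lt => e /lf; rewrite near_map; apply: filterS => s /=.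
by rewrite sub0r normrN normr_id (scalar_formB l_lin) distrC.
Qed.

Lemma cvg_weak_cvg (R : realType) (X : normedModType R) (T : Type)
    (F : set_system T) {FF : Filter F} (f : T -> X) (x : X) :
  f @ F --> x -> (f : T -> weak X) @ F --> (x : weak X).
Proof.
move=> fx; apply/weak_cvgP => l [l_lin lc]; apply/cvgrPdist_lt => e e0.
have /cvgrPdist_lt/(_ e e0) := cvg_comp _ _ fx (lc x).
rewrite !near_map; apply: filterS => s /=.
by rewrite sub0r normrN normr_id (scalar_formB l_lin) distrC.
Qed.

Theorem theorem5p4p2 (R : realType)
    (X3 X2 X1 : completeNormedModType R)
    (j32 : {linear X3 -> X2}) (j21 : {linear X2 -> X1})
    (j32_inj : injective j32) (j32_cont : continuous j32)
    (j21_inj : injective j21) (j21_cont : continuous j21)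
    (I : set R) (I_open : open I) (I_itv : is_interval I)
    (u du : R -> X3)
    (hyp_i_ii :
      ((forall t, I t -> has_derivative (j21 \o j32 \o u : R -> X1)
                           t (j21 (j32 (du t)))) /\
       {within I, continuous (j21 \o j32 \o du : R -> X1)})
      \/
      ((forall t, I t -> has_derivative (j21 \o j32 \o u : R -> weak X1)
                           t (j21 (j32 (du t)))) /\
       {within I, continuous (j21 \o j32 \o du : R -> weak X1)}))
    (hyp_iii : precompact (j32 @` closure (du @` I))) :
  (forall t, I t -> has_derivative (j32 \o u : R -> X2) t (j32 (du t))) /\
  {within I, continuous (j32 \o du : R -> X2)}.
Proof.
pose L := [set (l \o j21 : X2 -> R) | l in @topological_dual R X1].
have L_dual : L `<=` topological_dual (X := X2).
  move=> _ [l [l_lin lc] <-]; split=> [a x y|x] /=.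
    by rewrite linearP l_lin.
  exact: continuous_comp (j21_cont x) (lc _).
have L_sep x y : (forall l, L l -> l x = l y) -> x = y.
  move=> Lxy; apply/j21_inj/topological_dual_separates => l dl.
  by apply: (Lxy (l \o j21)); exists l.
(* The norm version implies the weak one, so only the weak one is kept. *)
have {hyp_i_ii} [u_der du_cont] :
    (forall t, I t -> has_derivative (j21 \o j32 \o u : R -> weak X1)
                         t (j21 (j32 (du t)))) /\
    {within I, continuous (j21 \o j32 \o du : R -> weak X1)}.
  case: hyp_i_ii => -[u_der du_cont]; split=> // [t It|t].
    exact: cvg_weak_cvg (u_der t It).
  exact: cvg_weak_cvg (du_cont t).
have w_cont t : I t -> {for t, continuous (j32 \o du : R -> X2)}.
  (* The outer closure, taken in [X2], is the set that (iii) makes compact. *)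
  move=> It; pose K := closure (j32 @` closure (du @` I)).
  apply: (weak_continuous_compact L_dual L_sep (K := K)).
  - by rewrite -precompactE.
  - apply: filterS (open_nbhs_nbhs (conj I_open It)) => s Is.
    apply/subset_closure; exists (du s) => //.
    by apply: subset_closure; exists s.
  - move=> _ [l dl <-]; move: du_cont.
    rewrite continuous_open_subspace// => du_cont.
    exact: weak_cvg_dual dl (du_cont t (mem_set It)).
split; last first.
  by rewrite continuous_open_subspace// => t /set_mem; exact: w_cont.
move=> t It; apply: (weak_derivative_strong L_dual L_sep I_open It w_cont).
move=> _ [l dl <-] x Ix; have /(weak_cvg_dual dl) := u_der x Ix.
have [l_lin _] := dl.
apply: cvg_trans; apply: near_eq_cvg; apply: nearW => h /=.
by rewrite (scalar_formZ l_lin) (scalar_formB l_lin).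
Qed.
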